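(* Let $n\ge 1$, let $\delta=(\delta_1,\dots,\delta_n)\in\mathbb{N}^n$, and let $p(x)=\sum_{I\le\delta}p_I x^I$ be a real polynomial in $x=(x_1,\dots,x_n)$ of multi-degree at most $\delta$, with Bernstein coefficients $(b_{I,\delta})_{I\le\delta}$. Let $p^*=\min_{x\in[0,1]^n}p(x)$. Let $p_\delta^{(0)}$, $p_\delta^{(1)}$, $p_\delta^{(2)}$ be the optimal values of the linear programs $(\mathrm{LP}_0)$, $(\mathrm{LP}_1)$, $(\mathrm{LP}_2)$ defined in the context. Then $$p_\delta^{(0)}\le p_\delta^{(1)}\le p_\delta^{(2)}\le p^*.$$
   Context: Multi-index notation: for $I=(i_1,\dots,i_n),J=(j_1,\dots,j_n)\in\mathbb{N}^n$, $I\le J$ means $i_l\le j_l$ for all $l$; $x^I=x_1^{i_1}\cdots x_n^{i_n}$; $\binom{I}{J}=\prod_{l}\binom{i_l}{j_l}$; $\frac{I}{J}=(i_1/j_1,\dots,i_n/j_n)$ (with the convention $0/0=0$); for $r\in\{1,\dots,n\}$ and $k\in\mathbb{Z}$, $I_{r,k}=(i_1,\dots,i_{r-1},i_r+k,i_{r+1},\dots,i_n)$. Bernstein polynomials: for $I\le K$ in $\mathbb{N}^n$, $B_{I,K}(x)=\prod_{l=1}^n\binom{K_l}{i_l}x_l^{i_l}(1-x_l)^{K_l-i_l}$. The Bernstein coefficients of $p=\sum_{I\le\delta}p_Ix^I$ are $b_{I,\delta}=\sum_{J\le I}\frac{\binom{I}{J}}{\binom{\delta}{J}}p_J$, so that $p=\sum_{I\le\delta}b_{I,\delta}B_{I,\delta}$.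 Linear programs: $(\mathrm{LP}_0)$: minimize $\sum_{I\le\delta}b_{I,\delta}z_{I,\delta}$ over reals $z_{I,\delta}$ ($I\le\delta$) subject to $z_{I,\delta}\ge0$ for all $I\le\delta$ and $\sum_{I\le\delta}z_{I,\delta}=1$. $(\mathrm{LP}_1)$: the same as $(\mathrm{LP}_0)$ with the additional constraints $z_{I,\delta}\le B_{I,\delta}\left(\frac{I}{\delta}\right)$ for all $I\le\delta$. $(\mathrm{LP}_2)$: minimize $\sum_{I\le\delta}b_{I,\delta}z_{I,\delta}$ over reals $z_{I,K}$ (for all $K\le\delta$ and $I\le K$) subject to: $0\le z_{I,K}\le B_{I,K}\left(\frac{I}{K}\right)$ for all $I\le K\le\delta$; $\sum_{I\le K}z_{I,K}=1$ for all $K\le\delta$; and $$z_{I,K_{r,-1}}=\frac{K_r-i_r}{K_r}z_{I,K}+\frac{i_r+1}{K_r}z_{I_{r,1},K}$$ for all $K\le\delta$, all $I\le K$ and all $r\in\{1,\dots,n\}$ with $I_{r,1}\le K$. *)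

(* Defs.v *)
From mathcomp Require Import all_boot all_order all_algebra.
From mathcomp Require Import classical_sets reals.
From mathcomp Require Import mpoly.

Set Implicit Arguments.
Unset Strict Implicit.
Unset Printing Implicit Defensive.

Import Order.TTheory GRing.Theory Num.Theory.

Local Open Scope ring_scope.
Local Open Scope classical_set_scope.

(* Multi-indices are multinomials 'X_{1..n}, with the componentwise order
   (_ <= _)%MM and the (truncated) componentwise operations of multi_scope.
   A sum over all I <= delta is written as a sum over the finite type
   'X_{1..n < (mdeg delta).+1}, which contains every such I, since I <= delta
   implies mdeg I <= mdeg delta. *)

Definition is_min (R : realType) (A : set R) (v : R) : Prop :=
  A v /\ lbound A v.

Definition multidegree_le (R : realType) (n : nat) (delta : 'X_{1..n})
    (p : {mpoly R[n]}) : Prop :=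
  forall I : 'X_{1..n}, p@_I != 0 -> (I <= delta)%MM.

Definition unit_cube (R : realType) (n : nat) : set ('I_n -> R) :=
  [set x : 'I_n -> R | forall l, 0 <= x l <= 1].

Definition poly_values (R : realType) (n : nat) (p : {mpoly R[n]}) : set R :=
  [set p.@[x] | x in @unit_cube R n].

Definition mbinom (n : nat) (I J : 'X_{1..n}) : nat :=
  (\prod_(l < n) 'C(I l, J l))%N.

(* The convention 0 / 0 = 0 is that of division in a MathComp field. *)
Definition mratio (R : realType) (n : nat) (I J : 'X_{1..n}) : 'I_n -> R :=
  fun l => (I l)%:R / (J l)%:R.

Definition bernstein (R : realType) (n : nat) (I K : 'X_{1..n})
    (x : 'I_n -> R) : R :=
  \prod_(l < n) ('C(K l, I l)%:R * x l ^+ I l * (1 - x l) ^+ (K l - I l)).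

Definition bernstein_coef (R : realType) (n : nat) (delta : 'X_{1..n})
    (p : {mpoly R[n]}) (I : 'X_{1..n}) : R :=
  \sum_(J : 'X_{1..n < (mdeg I).+1} | (J <= I)%MM)
     (mbinom I J)%:R / (mbinom delta J)%:R * p@_J.

(* A family z indexed by the I <= delta is represented by a function on all
   multi-indices; the values at other indices are unconstrained and do not
   enter the objective. In the second relaxation z I K stands for z_{I,K},
   and likewise only the values at I <= K <= delta matter. *)
Definition lp_objective (R : realType) (n : nat) (delta : 'X_{1..n})
    (p : {mpoly R[n]}) (z : 'X_{1..n} -> R) : R :=
  \sum_(I : 'X_{1..n < (mdeg delta).+1} | (I <= delta)%MM)
     bernstein_coef delta p I * z I.

Definition lp0_feasible (R : realType) (n : nat) (delta : 'X_{1..n}) :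
    set ('X_{1..n} -> R) :=
  [set z : 'X_{1..n} -> R |
    (forall I : 'X_{1..n}, (I <= delta)%MM -> 0 <= z I) /\
    \sum_(I : 'X_{1..n < (mdeg delta).+1} | (I <= delta)%MM) z I = 1].

Definition lp1_feasible (R : realType) (n : nat) (delta : 'X_{1..n}) :
    set ('X_{1..n} -> R) :=
  [set z : 'X_{1..n} -> R |
    lp0_feasible delta z /\
    forall I : 'X_{1..n}, (I <= delta)%MM ->
      z I <= bernstein I delta (mratio R I delta)].

Definition lp2_feasible (R : realType) (n : nat) (delta : 'X_{1..n}) :
    set ('X_{1..n} -> 'X_{1..n} -> R) :=
  [set z : 'X_{1..n} -> 'X_{1..n} -> R |
    [/\ forall K I : 'X_{1..n}, (K <= delta)%MM -> (I <= K)%MM ->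
          0 <= z I K <= bernstein I K (mratio R I K),
        forall K : 'X_{1..n}, (K <= delta)%MM ->
          \sum_(I : 'X_{1..n < (mdeg K).+1} | (I <= K)%MM) z I K = 1
      & forall (K I : 'X_{1..n}) (r : 'I_n),
          (K <= delta)%MM -> (I <= K)%MM -> (I + U_(r) <= K)%MM ->
          z I (K - U_(r))%MM =
            (K r - I r)%:R / (K r)%:R * z I K +
            (I r).+1%:R / (K r)%:R * z (I + U_(r))%MM K]].

Definition lp0_values (R : realType) (n : nat) (delta : 'X_{1..n})
    (p : {mpoly R[n]}) : set R :=
  [set lp_objective delta p z | z in @lp0_feasible R n delta].

Definition lp1_values (R : realType) (n : nat) (delta : 'X_{1..n})
    (p : {mpoly R[n]}) : set R :=
  [set lp_objective delta p z | z in @lp1_feasible R n delta].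

Definition lp2_values (R : realType) (n : nat) (delta : 'X_{1..n})
    (p : {mpoly R[n]}) : set R :=
  [set lp_objective delta p (fun I => z I delta)
     | z in @lp2_feasible R n delta].

(* Main.v *)
Require Import Defs.
From mathcomp Require Import all_boot all_order all_algebra.
From mathcomp Require Import classical_sets reals.
From mathcomp Require Import -(notations) mpoly.
From mathcomp Require Import boolp topology normedtype derive realfun ring zify.

(** For a point [x] of the unit cube, the numbers [z I K = bernstein I K x] form
    a feasible point of the strongest program, and its objective is [p(x)].
    Feasibility splits along the coordinates, since [bernstein I K] is a product
    of univariate Bernstein polynomials: these are nonnegative and sum to one,
    the [i]-th one of degree [d] is largest at [i / d] ([bern_le_mode], an
    arithmetic-geometric mean inequality), and degree elevation
    ([bern_degree_elevation]) is the recurrence between consecutive degrees.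
    The objective is [p(x)] because Bernstein weights turn binomial coefficients
    in the index back into monomials: the mean of ['C(i, j)] for a binomial law
    of parameters [d] and [x] is ['C(d, j) x^j] ([bern_moment]). So every value
    of [p] on the cube is a value of the second relaxation. Values of the second
    relaxation are values of the first, by keeping only the indices [K = delta],
    and those are values of the zeroth one, by dropping constraints. The three
    inequalities between minima follow from these inclusions.

    It remains to see that each of the four infima is attained. Every feasible
    set is closed and bounded in the finitely many coordinates that matter, so
    after setting the other coordinates to zero it lies in a product of
    segments, which is compact by Tychonoff, and a continuous function has a
    minimum there ([min_attained]). The inclusions above also show that no
    feasible set is empty. *)

Set Implicit Arguments.
Unset Strict Implicit.
Unset Printing Implicit Defensive.

Import Order.TTheory GRing.Theory Num.Theory.
Import numFieldNormedType.Exports.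
Import ArrowAsProduct.

Local Open Scope classical_set_scope.
Local Open Scope ring_scope.

Delimit Scope multi_scope with MM.
Local Notation "I <= K" := (mpoly.lem I K) : multi_scope.
Local Notation "I + J" := (mnm_add I J) : multi_scope.
Local Notation "I - J" := (mnm_sub I J) : multi_scope.

(** * Minima of functions of finitely many bounded coordinates *)

Lemma continuous_coord (R : realType) (U : eqType) (u : U) :
  continuous (fun z : U -> R => z u).
Proof. exact: (@proj_continuous U (fun=> R) u). Qed.

Lemma continuous_lin (R : realType) (U : eqType) (T : Type) (r : seq T)
    (P : pred T) (c : T -> R) (h : T -> U) :
  continuous (fun z : U -> R => \sum_(i <- r | P i) c i * z (h i)).
Proof.
apply: continuous_big => [|i _]; first exact: add_continuous.
move=> z; apply: continuousM; [exact: cst_continuous|exact: continuous_coord].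
Qed.

Lemma continuous_lin2 (R : realType) (U : eqType) (a b : R) (u v : U) :
  continuous (fun z : U -> R => a * z u + b * z v).
Proof.
have cZ c w : continuous (fun z : U -> R => c * z w).
  move=> z; apply: continuousM; [exact: cst_continuous|exact: continuous_coord].
by move=> z; apply: (@continuousD _ _ _ (fun z : U -> R => a * z u)
  (fun z : U -> R => b * z v)); exact: cZ.
Qed.

Lemma closed_eq_fun (R : realType) (T : topologicalType) (f g : T -> R) :
  continuous f -> continuous g -> closed [set z | f z = g z].
Proof.
move=> cf cg.
have -> : [set z | f z = g z] = (fun z => f z - g z) @^-1` [set x | x = 0].
  by apply/seteqP; split=> z /= => [->|/subr0_eq//]; rewrite subrr.
apply: closed_comp; last exact: closed_eq.
by move=> z _; apply: continuousB; [exact: cf|exact: cg].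
Qed.

Lemma closed_forall (T : topologicalType) (I : Type) (A : I -> set T) :
  (forall i, closed (A i)) -> closed [set z | forall i, A i z].
Proof.
move=> cA; have -> : [set z | forall i, A i z] = \bigcap_i A i.
  by apply/seteqP; split=> z /= h i => [_|]; exact: h.
exact: closed_bigI.
Qed.

Lemma closed_imply (T : topologicalType) (P : Prop) (A : set T) :
  closed A -> closed [set z | P -> A z].
Proof. by move=> cA; apply: (@closed_forall T P (fun=> A)). Qed.

Lemma closed_ge_coord (R : realType) (U : eqType) (u : U) (a : R) :
  closed [set z : U -> R | a <= z u].
Proof.
apply: (@closed_comp _ _ (fun z : U -> R => z u) [set x | a <= x]).
  by move=> z _; exact: continuous_coord.
exact: closed_ge.
Qed.

Lemma closed_le_coord (R : realType) (U : eqType) (u : U) (a : R) :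
  closed [set z : U -> R | z u <= a].
Proof.
apply: (@closed_comp _ _ (fun z : U -> R => z u) [set x | x <= a]).
  by move=> z _; exact: continuous_coord.
exact: closed_le.
Qed.

Lemma closed_itv_coord (R : realType) (U : eqType) (u : U) (a b : R) :
  closed [set z : U -> R | a <= z u <= b].
Proof.
have -> : [set z : U -> R | a <= z u <= b] =
    [set x | a <= x u] `&` [set x | x u <= b].
  by apply/seteqP; split=> x /= /andP.
by apply: closedI; [exact: closed_ge_coord|exact: closed_le_coord].
Qed.

(** The set [S] may be unbounded in the coordinates outside [D], so it need not
    be compact. As neither [S] nor [F] sees those coordinates, they can be set to
    zero, and the truncated points of [S] form a closed part of a product of
    segments. *)
Lemma min_attained (R : realType) (U : eqType) (D : pred U) (lo hi : U -> R)
    (S : set (U -> R)) (F : (U -> R) -> R) :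
  continuous F -> closed S ->
  (forall z, S z -> forall u, D u -> lo u <= z u <= hi u) ->
  (forall z z', (forall u, D u -> z u = z' u) -> S z -> S z' /\ F z = F z') ->
  S !=set0 -> exists v, is_min [set F z | z in S] v.
Proof.
move=> cF clS bnd dep [z0 Sz0].
pose trunc (z : U -> R) u := if D u then z u else 0.
have truncP z u : D u -> z u = trunc z u by move=> Du; rewrite /trunc ifT.
pose A u : set R := [set` if D u then `[lo u, hi u] else `[0, 0]].
pose B := [set z : U -> R | forall u, A u (z u)].
have cB : compact B.
  apply: (@tychonoff U (fun=> R) A) => u; rewrite /A.
  by case: (D u); exact: segment_compact.
have truncB z : S z -> B (trunc z).
  move=> Sz u; rewrite /A /trunc; case: ifPn => Du /=; rewrite in_itv/= ?lexx//.
  exact: bnd.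
have B0 : (B `&` S) !=set0.
  by exists (trunc z0); split; [exact: truncB|have [] := dep _ _ (truncP z0) Sz0].
have [|c /[!inE] -[Bc Sc] cmin] :=
    @compact_EVT_min _ _ F _ B0 (compact_closedI cB clS).
  exact: continuous_subspaceT.
exists (F c); split; first by exists c.
move=> _ [z Sz <-]; have [St ->] := dep _ _ (truncP z) Sz.
by apply: cmin; rewrite inE; split; [exact: truncB|].
Qed.

(** * Univariate Bernstein polynomials *)

Definition bern (R : pzRingType) (d i : nat) (x : R) : R :=
  'C(d, i)%:R * x ^+ i * (1 - x) ^+ (d - i).

(** Since ['C(i, j) 'C(d, i) = 'C(d, j) 'C(d - j, i - j)], the sum is
    ['C(d, j) x^j] times the binomial expansion of [(x + (1 - x))^(d - j)]. This
    inverts the change of basis behind the Bernstein coefficients. *)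
Lemma bern_moment (R : comPzRingType) (d j : nat) (x : R) : (j <= d)%N ->
  \sum_(i < d.+1) 'C(i, j)%:R * bern d i x = 'C(d, j)%:R * x ^+ j.
Proof.
move=> jd.
have bin_mul m : ('C(m + j, j) * 'C(d, m + j) = 'C(d, j) * 'C(d - j, m))%N.
  have [md|md] := leqP (m + j) d; last first.
    rewrite (bin_small md) muln0 (@bin_small (d - j)) ?muln0//.
    by rewrite ltn_subLR// addnC.
  have mdj : (m <= d - j)%N by rewrite leq_subRL// addnC.
  have jm : (j <= m + j)%N by rewrite leq_addl.
  apply/eqP; rewrite -(eqn_pmul2r (fact_gt0 j)) -(eqn_pmul2r (fact_gt0 m)).
  rewrite -(eqn_pmul2r (fact_gt0 (d - (m + j)))).
  have := bin_fact md; have := bin_fact jd; have := bin_fact mdj.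
  have := bin_fact jm; rewrite addnK -subnDA [(j + m)%N]addnC.
  set a := 'C(m + j, j); set b := 'C(d, m + j); set c := 'C(d - j, m).
  set e := 'C(d, j) => h1 h2 h3 h4; apply/eqP.
  have -> : (a * b * j`! * m`! * (d - (m + j))`! =
     b * (a * (j`! * m`!) * (d - (m + j))`!))%N by ring.
  rewrite h1 h4 -h3 -h2; ring.
rewrite -(big_mkord predT (fun i => 'C(i, j)%:R * bern d i x)).
(* The terms with i < j vanish; the others are reindexed by m = i - j. *)
rewrite (@big_cat_nat _ _ _ j) //=; last by rewrite leqW.
rewrite big_nat big1 ?add0r => [|i /andP[_ ij]]; last first.
  by rewrite bin_small// mul0r.
rewrite -{1}[j]add0n big_addn.
rewrite (eq_bigr (fun m => 'C(d, j)%:R * x ^+ j *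
    ((1 - x) ^+ (d - j - m) * x ^+ m *+ 'C(d - j, m)))); last first.
  move=> m _; rewrite /bern mulrA mulrA -natrM bin_mul natrM addnC exprD subnDA.
  by rewrite -mulr_natl; ring.
by rewrite -big_distrr /= subSn// big_mkord -exprDn subrK expr1n mulr1.
Qed.

Lemma bern_sum1 (R : comPzRingType) (d : nat) (x : R) :
  \sum_(i < d.+1) bern d i x = 1.
Proof.
have := bern_moment x (leq0n d); rewrite bin0 expr0 mulr1 mulr1n => <-.
by apply: eq_bigr => i _; rewrite bin0 mul1r.
Qed.

Lemma bern_ge0 (R : numDomainType) (d i : nat) (x : R) :
  0 <= x <= 1 -> 0 <= bern d i x.
Proof.
by case/andP=> x0 x1; rewrite /bern !mulr_ge0 ?exprn_ge0// subr_ge0.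
Qed.

(** This is the arithmetic-geometric mean inequality for [i] numbers [x / i] and
    [j] numbers [(1 - x) / j], whose sum is at most 1. It can fall short of 1
    when [i] or [j] is 0, since the corresponding numbers are then absent. *)
Lemma expr_sub_AGM (R : numFieldType) (i j : nat) (x : R) : 0 <= x <= 1 ->
  x ^+ i * (1 - x) ^+ j <=
    (i%:R / (i + j)%:R) ^+ i * (j%:R / (i + j)%:R) ^+ j.
Proof.
case/andP=> x0 x1.
have y0 : 0 <= 1 - x by rewrite subr_ge0.
(* For m = 0 both sides are 1, so i = 0 and j = 0 need no separate treatment. *)
have splt m (t : R) : t ^+ m = m%:R ^+ m * (t / m%:R) ^+ m.
  case: m => [|m]; first by rewrite !expr0 mulr1.
  by rewrite -exprMn mulrCA divff ?mulr1// pnatr_eq0.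
have mdiv m (t : R) : 0 <= t -> (t / m%:R) *+ m <= t.
  case: m => [|m] t0; first by rewrite mulr0n.
  by rewrite -mulr_natr mulfVK// pnatr_eq0.
rewrite (splt i) (splt j) !exprMn mulrACA [leRHS]mulrACA.
rewrite ler_wpM2l ?mulr_ge0 ?exprn_ge0//.
pose n := (i + j)%N.
have [n0|n_gt0] := posnP n.
  move/eqP: n0; rewrite /n addn_eq0 => /andP[/eqP-> /eqP->].
  by rewrite !expr0 !mulr1.
(* The sum type carries i copies of the first number and j of the second. *)
pose E (k : 'I_i + 'I_j) := if k is inl _ then x / i%:R else (1 - x) / j%:R.
have E0 k : 0 <= E k by case: k => k; rewrite /= divr_ge0.
have En : #|{: 'I_i + 'I_j}| = n by rewrite card_sum !card_ord.
have [+ _] := @leif_AGM_scaled R _ predT E (fun k _ => mulrn_wge0 _ (E0 k)).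
rewrite En big_sumType/= big_sumType/= !prodr_const !sumr_const !card_ord => AGM.
have {AGM} : (x / i%:R *+ n) ^+ i * ((1 - x) / j%:R *+ n) ^+ j <= 1.
  apply: le_trans AGM _; apply: exprn_ile1.
    by rewrite addr_ge0// mulrn_wge0// divr_ge0.
  by rewrite (le_trans (lerD (mdiv _ _ x0) (mdiv _ _ y0)))// addrC subrK.
rewrite -(mulr_natr (x / _) n) -(mulr_natr ((1 - x) / _) n) !exprMn.
rewrite [X in X <= 1 -> _]mulrACA => h.
rewrite !exprVn -invfM -[leRHS]mul1r ler_pdivlMr -?exprVn//.
by rewrite mulr_gt0// exprn_gt0// ltr0n.
Qed.

Lemma bern_le_mode (R : numFieldType) (d i : nat) (x : R) :
  (i <= d)%N -> 0 <= x <= 1 -> bern d i x <= bern d i (i%:R / d%:R).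
Proof.
move=> id x01; have [d_0|d0] := posnP d.
  by move: id; rewrite d_0 leqn0 => /eqP->.
have -> : bern d i (i%:R / d%:R : R) = 'C(d, i)%:R *
   ((i%:R / (i + (d - i))%:R) ^+ i * ((d - i)%:R / (i + (d - i))%:R) ^+ (d - i)).
  rewrite /bern subnKC// natrB// mulrBl divff ?mulrA// pnatr_eq0 -lt0n//.
by rewrite /bern -mulrA ler_wpM2l// expr_sub_AGM.
Qed.

Lemma bern_degree_elevation (R : numFieldType) (d i : nat) (x : R) :
  (i < d)%N ->
  bern d.-1 i x =
    (d - i)%:R / d%:R * bern d i x + i.+1%:R / d%:R * bern d i.+1 x.
Proof.
move=> id; have d0 : d%:R != 0 :> R.
  by rewrite pnatr_eq0 -lt0n (leq_ltn_trans _ id).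
have down : d%:R * 'C(d.-1, i)%:R = (d - i)%:R * 'C(d, i)%:R :> R.
  by rewrite -!natrM mul_bin_down.
have diag : d%:R * 'C(d.-1, i)%:R = i.+1%:R * 'C(d, i.+1)%:R :> R.
  by rewrite -!natrM mul_bin_diag.
apply: (mulfI d0); rewrite /bern.
have -> : (d.-1 - i = d - i.+1)%N by rewrite -subn1 -subnDA add1n.
have -> : (1 - x) ^+ (d - i) = (1 - x) * (1 - x) ^+ (d - i.+1).
  by rewrite -exprS subnSK.
rewrite exprS; set y := _ ^+ (d - i.+1).
transitivity (((d - i)%:R * 'C(d, i)%:R) * (x ^+ i * ((1 - x) * y)) +
              (i.+1%:R * 'C(d, i.+1)%:R) * (x * x ^+ i * y)).
  by rewrite -down -diag; ring.
by field.
Qed.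

(** * Sums over a box of multi-indices *)

Lemma lem_mdeg (n : nat) (I K : multinom n) : (I <= K)%MM -> (mdeg I <= mdeg K)%N.
Proof. by move/mnm_lepP=> IK; rewrite !mdegE; apply: leq_sum. Qed.

Lemma lem_mdeg_lt (n : nat) (I K : multinom n) :
  (I <= K)%MM -> (mdeg I < (mdeg K).+1)%N.
Proof. by rewrite ltnS; exact: lem_mdeg. Qed.

Lemma coord_le_mdeg (n : nat) (I : multinom n) (l : 'I_n) : (I l <= mdeg I)%N.
Proof. by rewrite mdegE (bigD1 l)//= leq_addr. Qed.

(** The sum in a Bernstein coefficient and the sum in the objective range over
    types with different degree bounds; this brings them to a common one. *)
Lemma sum_box_widen (V : nmodType) (n : nat) (K L : multinom n)
    (F : multinom n -> V) : (K <= L)%MM ->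
  \sum_(I : bmultinom n (mdeg K).+1 | (I <= K)%MM) F I =
  \sum_(I : bmultinom n (mdeg L).+1 | (I <= K)%MM) F I.
Proof.
move=> KL.
have val_insub (I : bmultinom n (mdeg L).+1) : (I <= K)%MM ->
    insubd (bm0 : bmultinom n (mdeg K).+1) (bmnm I) = bmnm I :> multinom n.
  by move=> IK; rewrite insubdK// unfold_in lem_mdeg_lt.
have val_insub' (I : bmultinom n (mdeg K).+1) :
    insubd (bm0 : bmultinom n (mdeg L).+1) (bmnm I) = bmnm I :> multinom n.
  by rewrite insubdK// unfold_in (leq_trans (bmdeg I))// ltnS lem_mdeg.
rewrite [RHS](reindex_onto
  (fun I : bmultinom n (mdeg K).+1 => insubd bm0 (bmnm I))
  (fun I : bmultinom n (mdeg L).+1 => insubd bm0 (bmnm I))) /=; last first.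
  by move=> I IK; apply: val_inj; rewrite /= val_insub' val_insub.
apply: eq_big => [I|I _]; rewrite val_insub'//.
have -> : insubd bm0 (bmnm I) = I by apply: val_inj; rewrite valKd.
by rewrite eqxx andbT.
Qed.

(** A box is a product of intervals, so this is distributivity, once the
    intervals are seen inside a common one and multi-indices are identified with
    finite functions into it. *)
Lemma sum_box_prod (R : comNzRingType) (n : nat) (K : multinom n)
    (f : 'I_n -> nat -> R) :
  \sum_(I : bmultinom n (mdeg K).+1 | (I <= K)%MM) \prod_(l < n) f l (I l) =
  \prod_(l < n) \sum_(i < (K l).+1) f l i.
Proof.
have Kl l : ((K l).+1 <= (mdeg K).+1)%N.
  by rewrite ltnS coord_le_mdeg.
(* All factors are made sums over the same ordinal type. *)
under [RHS]eq_bigr do rewrite (big_ord_widen _ _ (Kl _)).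
rewrite bigA_distr_big_dep.
pose h (I : bmultinom n (mdeg K).+1) : {ffun 'I_n -> 'I_(mdeg K).+1} :=
  [ffun l => inord (I l)].
pose h' (g : {ffun 'I_n -> 'I_(mdeg K).+1}) : bmultinom n (mdeg K).+1 :=
  insubd bm0 (Multinom [tuple (g l : nat) | l < n]).
have hE I l : h I l = I l :> nat.
  by rewrite ffunE inordK// (leq_trans _ (bmdeg I))// ltnS coord_le_mdeg.
rewrite [RHS](reindex_onto h h').
  apply: eq_big => [I|I _]; last by apply: eq_bigr => l _; rewrite hE.
  have -> : h' (h I) = I.
    apply: val_inj; rewrite /h'.
    have -> : Multinom [tuple (h I l : nat) | l < n] = bmnm I.
      by apply/mnmP => l; rewrite mnmE hE.
    by rewrite valKd.
  rewrite eqxx andbT; apply/mnm_lepP/familyP => IK l.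
    by rewrite unfold_in hE ltnS.
  by have := IK l; rewrite unfold_in hE ltnS.
move=> g /familyP gK; apply/ffunP => l; apply: val_inj; rewrite /= hE /h'.
rewrite insubdK ?mnmE// unfold_in lem_mdeg_lt//; apply/mnm_lepP => k.
by rewrite mnmE -ltnS; have := gK k; rewrite unfold_in.
Qed.

(** * Multivariate Bernstein polynomials *)

Lemma bernsteinE (R : realType) (n : nat) (I K : multinom n)
    (x : 'I_n -> R) : bernstein I K x = \prod_(l < n) bern (K l) (I l) (x l).
Proof. by []. Qed.

Lemma bernstein_ge0 (R : realType) (n : nat) (I K : multinom n)
    (x : 'I_n -> R) : unit_cube x -> 0 <= bernstein I K x.
Proof. by move=> x01; apply: prodr_ge0 => l _; exact: bern_ge0. Qed.

Lemma bernstein_le_mode (R : realType) (n : nat) (I K : multinom n)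
    (x : 'I_n -> R) : unit_cube x -> (I <= K)%MM ->
  bernstein I K x <= bernstein I K (mratio R I K).
Proof.
move=> x01 /mnm_lepP IK; apply: ler_prod => l _.
by rewrite (bern_ge0 _ _ (x01 l)) bern_le_mode.
Qed.

Lemma bernstein_sum1 (R : realType) (n : nat) (K : multinom n)
    (x : 'I_n -> R) :
  \sum_(I : bmultinom n (mdeg K).+1 | (I <= K)%MM) bernstein I K x = 1.
Proof.
rewrite (@sum_box_prod R n K (fun l i => bern (K l) i (x l))).
by rewrite big1// => l _; exact: bern_sum1.
Qed.

Lemma bernstein_moment (R : realType) (n : nat) (J K : multinom n)
    (x : 'I_n -> R) : (J <= K)%MM ->
  \sum_(I : bmultinom n (mdeg K).+1 | (I <= K)%MM)
     (mbinom I J)%:R / (mbinom K J)%:R * bernstein I K x =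
  \prod_(l < n) x l ^+ J l.
Proof.
move=> /mnm_lepP JK.
have binK0 : (mbinom K J)%:R != 0 :> R.
  by rewrite pnatr_eq0 -lt0n prodn_gt0// => l; rewrite bin_gt0.
apply: (mulfI binK0); rewrite big_distrr/=.
under eq_bigr => I _ do rewrite mulrA mulrCA divff// mulr1 natr_prod -big_split/=.
rewrite (@sum_box_prod R n K (fun l i => 'C(i, J l)%:R * bern (K l) i (x l))).
by rewrite natr_prod -big_split/=; apply: eq_bigr => l _; rewrite bern_moment.
Qed.

(** Only the factor of the coordinate [r] changes, and there the identity is
    degree elevation. *)
Lemma bernstein_recurrence (R : realType) (n : nat) (I K : multinom n)
    (r : 'I_n) (x : 'I_n -> R) : (I + mnm1 r <= K)%MM ->
  bernstein I (K - mnm1 r)%MM x =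
    (K r - I r)%:R / (K r)%:R * bernstein I K x +
    (I r).+1%:R / (K r)%:R * bernstein (I + mnm1 r)%MM K x.
Proof.
move=> /mnm_lepP/(_ r); rewrite mnmDE mnm1E eqxx addn1 => IKr.
rewrite !bernsteinE (bigD1 r)//= [X in _ = _ * X + _](bigD1 r)//=.
rewrite [X in _ = _ + _ * X](bigD1 r)//= mnmBE mnmDE !mnm1E eqxx subn1 addn1.
rewrite bern_degree_elevation// mulrDl !mulrA; congr (_ * _ + _ * _).
  by apply: eq_bigr => l lr; rewrite mnmBE mnm1E eq_sym (negPf lr) subn0.
apply: eq_bigr => l lr.
by rewrite mnmBE mnmDE mnm1E eq_sym (negPf lr) subn0 addn0.
Qed.

Lemma mbinom_eq0 (n : nat) (I J : multinom n) :
  ~~ (J <= I)%MM -> mbinom I J = 0%N.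
Proof.
rewrite negb_forall => /existsP[l]; rewrite -ltnNge => IJ.
by rewrite /mbinom (bigD1 l)//= bin_small.
Qed.

(** The binomial coefficients with [J] not below [I] vanish, so that the range of
    summation can be made independent of [I], which permits an exchange of sums
    in the objective. *)
Lemma bernstein_coefE (R : realType) (n : nat) (delta : multinom n)
    (p : mpoly n R) (I : multinom n) : (I <= delta)%MM ->
  bernstein_coef delta p I =
  \sum_(J : bmultinom n (mdeg delta).+1 | (J <= delta)%MM)
     (mbinom I J)%:R / (mbinom delta J)%:R * mcoeff J p.
Proof.
move=> Id; rewrite /bernstein_coef (sum_box_widen
  (fun J => (mbinom I J)%:R / (mbinom delta J)%:R * mcoeff J p) Id).
rewrite big_mkcond [RHS]big_mkcond; apply: eq_bigr => J _.
have [JI|JI] := boolP (J <= I)%MM; first by rewrite (lepm_trans JI Id).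
by rewrite mbinom_eq0// !mul0r if_same.
Qed.

Lemma meval_box (R : realType) (n : nat) (delta : multinom n)
    (p : mpoly n R) (x : 'I_n -> R) : multidegree_le delta p ->
  meval x p = \sum_(J : bmultinom n (mdeg delta).+1 | (J <= delta)%MM)
    mcoeff J p * \prod_(l < n) x l ^+ J l.
Proof.
move=> hp; have szp : (mmeasure mdeg p <= (mdeg delta).+1)%N.
  apply/bigmax_leqP_seq => m; rewrite mcoeff_msupp => /hp md _.
  exact: lem_mdeg_lt.
rewrite {1}(mpolywE szp) raddf_sum/= [RHS]big_mkcond; apply: eq_bigr => J _.
rewrite mevalZ mevalX; case: ifPn => // Jd.
have [->|/hp] := eqVneq (mcoeff J p) 0; first by rewrite mul0r.
by rewrite (negPf Jd).
Qed.

(** After exchanging the two sums, the factor of the coefficient of index [J] is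
    the moment computed in [bernstein_moment], that is, the monomial [x^J]. *)
Lemma lp_objective_bernstein (R : realType) (n : nat) (delta : multinom n)
    (p : mpoly n R) (x : 'I_n -> R) : multidegree_le delta p ->
  lp_objective delta p (fun I => bernstein I delta x) = meval x p.
Proof.
move=> hp; rewrite (meval_box x hp) /lp_objective.
under eq_bigr => I Id do rewrite bernstein_coefE// big_distrl/=.
rewrite exchange_big/=; apply: eq_bigr => J Jd.
rewrite -(bernstein_moment x Jd) big_distrr/=; apply: eq_bigr => I _.
by rewrite mulrCA mulrA mulrC.
Qed.

(** * Inclusions between the sets of values *)

Lemma bernstein_lp2_feasible (R : realType) (n : nat) (delta : multinom n)
    (x : 'I_n -> R) : unit_cube x ->
  lp2_feasible delta (fun I K => bernstein I K x).
Proof.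
move=> x01; split=> [K I Kd IK|K Kd|K I r Kd IK IrK].
- by rewrite bernstein_ge0// bernstein_le_mode.
- exact: bernstein_sum1.
- exact: bernstein_recurrence.
Qed.

Lemma lp2_feasible_lp1 (R : realType) (n : nat) (delta : multinom n)
    (z : multinom n -> multinom n -> R) :
  lp2_feasible delta z -> lp1_feasible delta (fun I => z I delta).
Proof.
case=> bnd sum1 _; have dd := lepm_refl delta; split; first split.
- by move=> I Id; have /andP[] := bnd _ _ dd Id.
- exact: sum1.
- by move=> I Id; have /andP[] := bnd _ _ dd Id.
Qed.

Lemma lp2_values_sub_lp1 (R : realType) (n : nat) (delta : multinom n)
    (p : mpoly n R) : lp2_values delta p `<=` lp1_values delta p.
Proof. by move=> _ [z /lp2_feasible_lp1 hz <-]; exists (fun I => z I delta). Qed.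

Lemma lp1_values_sub_lp0 (R : realType) (n : nat) (delta : multinom n)
    (p : mpoly n R) : lp1_values delta p `<=` lp0_values delta p.
Proof. by move=> _ [z [hz _] <-]; exists z. Qed.

Lemma poly_values_sub_lp2 (R : realType) (n : nat) (delta : multinom n)
    (p : mpoly n R) : multidegree_le delta p ->
  poly_values p `<=` lp2_values delta p.
Proof.
move=> hp _ [x x01 <-]; exists (fun I K => bernstein I K x).
  exact: bernstein_lp2_feasible.
exact: lp_objective_bernstein.
Qed.

Lemma le_is_min (R : realType) (A B : set R) (a b : R) :
  A `<=` B -> is_min A a -> is_min B b -> b <= a.
Proof. by move=> AB [Aa _] [_]; apply; exact: AB. Qed.

Lemma poly_values_nonempty (R : realType) (n : nat) (p : mpoly n R) :
  poly_values p !=set0.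
Proof. by exists (meval (fun=> 0) p), (fun=> 0) => // l; rewrite lexx ler01. Qed.

(** * Attainment of the minima *)

Lemma poly_min_attained (R : realType) (n : nat) (p : mpoly n R) :
  exists v, is_min (poly_values p) v.
Proof.
apply: (@min_attained R 'I_n predT (fun=> 0) (fun=> 1)).
- have -> : (fun x => meval x p) =
      (fun x => \sum_(m <- msupp p) mcoeff m p * \prod_(l < n) x l ^+ m l).
    by apply/funext => x; rewrite mevalE.
  apply: continuous_big => [|m _]; first exact: add_continuous.
  move=> x; apply: continuousM; first exact: cst_continuous.
  move: x; apply: continuous_big => [|l _]; first exact: mul_continuous.
  move=> x; apply: (@continuous_comp _ _ _ (fun y : _ -> R => y l)
    (fun t => t ^+ m l)).
    exact: continuous_coord.
  exact: exprn_continuous.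
- by apply: closed_forall => l; exact: closed_itv_coord.
- by move=> x x01 l _; exact: x01.
- by move=> x y xy; have <- : x = y by apply/funext => l; exact: xy.
- by have [_ [x x01 _]] := poly_values_nonempty p; exists x.
Qed.

Lemma continuous_lp_objective (R : realType) (n : nat) (delta : multinom n)
    (p : mpoly n R) : continuous (lp_objective delta p).
Proof. exact: continuous_lin. Qed.

Lemma closed_lp0_feasible (R : realType) (n : nat) (delta : multinom n) :
  closed (@lp0_feasible R n delta).
Proof.
apply: closedI.
  by apply: closed_forall => I; apply: closed_imply; exact: closed_ge_coord.
apply: closed_eq_fun; last exact: cst_continuous.
apply: continuous_big => [|I _]; [exact: add_continuous|exact: continuous_coord].
Qed.

Lemma closed_lp1_feasible (R : realType) (n : nat) (delta : multinom n) :
  closed (@lp1_feasible R n delta).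
Proof.
apply: closedI; first exact: closed_lp0_feasible.
by apply: closed_forall => I; apply: closed_imply; exact: closed_le_coord.
Qed.

Lemma lp0_feasible_le1 (R : realType) (n : nat) (delta : multinom n)
    (z : multinom n -> R) I : lp0_feasible delta z -> (I <= delta)%MM ->
  0 <= z I <= 1.
Proof.
move=> [z0 z1] Id; rewrite z0//=; have /= dI := lem_mdeg_lt Id.
rewrite -z1 (bigD1 (BMultinom dI))//= lerDl.
by apply: sumr_ge0 => J /andP[Jd _]; exact: z0.
Qed.

Lemma eq_lp0_feasible (R : realType) (n : nat) (delta : multinom n)
    (z z' : multinom n -> R) : (forall I, (I <= delta)%MM -> z I = z' I) ->
  lp0_feasible delta z -> lp0_feasible delta z'.
Proof.
move=> zz' [z0 z1]; split=> [I Id|]; first by rewrite -zz'//; exact: z0.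
by rewrite -[RHS]z1; apply: eq_bigr => I Id; rewrite zz'.
Qed.

Lemma eq_lp1_feasible (R : realType) (n : nat) (delta : multinom n)
    (z z' : multinom n -> R) : (forall I, (I <= delta)%MM -> z I = z' I) ->
  lp1_feasible delta z -> lp1_feasible delta z'.
Proof.
move=> zz' [z0 z1]; split=> [|I Id]; first exact: eq_lp0_feasible z0.
by rewrite -zz'//; exact: z1.
Qed.

Lemma eq_lp_objective (R : realType) (n : nat) (delta : multinom n)
    (p : mpoly n R) (z z' : multinom n -> R) :
  (forall I, (I <= delta)%MM -> z I = z' I) ->
  lp_objective delta p z = lp_objective delta p z'.
Proof. by move=> zz'; apply: eq_bigr => I Id; rewrite zz'. Qed.

Lemma lp0_min_attained (R : realType) (n : nat) (delta : multinom n)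
    (p : mpoly n R) : lp0_values delta p !=set0 ->
  exists v, is_min (lp0_values delta p) v.
Proof.
move=> [_ [z0 hz0 _]].
apply: (@min_attained R _ (fun I => I <= delta)%MM (fun=> 0) (fun=> 1)).
- exact: continuous_lp_objective.
- exact: closed_lp0_feasible.
- by move=> z hz I; exact: lp0_feasible_le1.
- move=> z z' zz' hz; split; first exact: eq_lp0_feasible hz.
  exact: eq_lp_objective.
- by exists z0.
Qed.

Lemma lp1_min_attained (R : realType) (n : nat) (delta : multinom n)
    (p : mpoly n R) : lp1_values delta p !=set0 ->
  exists v, is_min (lp1_values delta p) v.
Proof.
move=> [_ [z0 hz0 _]].
apply: (@min_attained R _ (fun I => I <= delta)%MM (fun=> 0) (fun=> 1)).
- exact: continuous_lp_objective.
- exact: closed_lp1_feasible.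
- by move=> z [hz _] I; exact: lp0_feasible_le1.
- move=> z z' zz' hz; split; first exact: eq_lp1_feasible hz.
  exact: eq_lp_objective.
- by exists z0.
Qed.

(** Families with two indices are uncurried, so that the variables of the program
    become the coordinates of one product space. *)
Lemma lp2_min_attained (R : realType) (n : nat) (delta : multinom n)
    (p : mpoly n R) : lp2_values delta p !=set0 ->
  exists v, is_min (lp2_values delta p) v.
Proof.
move=> [_ [z0 hz0 _]].
pose U : eqType := (multinom n * multinom n)%type.
pose S := [set z : U -> R | lp2_feasible delta (fun I K => z (I, K))].
pose F (z : U -> R) := lp_objective delta p (fun I => z (I, delta)).
have -> : lp2_values delta p = [set F z | z in S].
  apply/seteqP; split=> _ [z hz <-]; last by exists (fun I K => z (I, K)).
  by exists (fun u => z u.1 u.2).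
apply: (@min_attained R _ (fun u : U => (u.2 <= delta)%MM && (u.1 <= u.2)%MM)
  (fun=> 0) (fun u => bernstein u.1 u.2 (mratio R u.1 u.2))).
- apply: (@continuous_lin _ _ _ _ _ _ (fun I : bmultinom n _ => (bmnm I, delta))).
- have -> : S = [set z | forall K I, (K <= delta)%MM -> (I <= K)%MM ->
          0 <= z (I, K) <= bernstein I K (mratio R I K)] `&`
      ([set z | forall K, (K <= delta)%MM ->
          \sum_(I : bmultinom n (mdeg K).+1 | (I <= K)%MM) z (bmnm I, K) = 1] `&`
       [set z | forall K I (r : 'I_n), (K <= delta)%MM -> (I <= K)%MM ->
          (I + mnm1 r <= K)%MM ->
          z (I, (K - mnm1 r)%MM) =
            (K r - I r)%:R / (K r)%:R * z (I, K) +
            (I r).+1%:R / (K r)%:R * z ((I + mnm1 r)%MM, K)]).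
    by apply/seteqP; split=> z; [case|case=> ? []].
  apply: closedI; last apply: closedI.
  + do 2 (apply: closed_forall => ?); do 2 apply: closed_imply.
    exact: closed_itv_coord.
  + apply: closed_forall => K; apply: closed_imply; apply: closed_eq_fun.
      apply: continuous_big => [|I _]; first exact: add_continuous.
      exact: continuous_coord.
    exact: cst_continuous.
  + do 3 (apply: closed_forall => ?); do 3 apply: closed_imply.
    apply: closed_eq_fun; first exact: continuous_coord.
    exact: continuous_lin2.
- by move=> z [bnd _ _] [I K] /andP[Kd IK]; exact: bnd.
- move=> z z' zz' [bnd sum1 rec].
  have zE I K : (K <= delta)%MM -> (I <= K)%MM -> z' (I, K) = z (I, K).
    by move=> Kd IK; rewrite zz'//= Kd.
  split; first split.
  + by move=> K I Kd IK; rewrite zE//; exact: bnd.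
  + by move=> K Kd; rewrite -[RHS](sum1 _ Kd); apply: eq_bigr => I IK; rewrite zE.
  + move=> K I r Kd IK IrK; rewrite !zE//; first exact: rec.
      by apply: lepm_trans Kd; exact: lem_subr.
    apply/mnm_lepP => l; have /mnm_lepP/(_ l) := IrK.
    by rewrite mnmDE mnmBE; lia.
  + by apply: eq_bigr => I Id; rewrite zE// lepm_refl.
- by exists (fun u => z0 u.1 u.2).
Qed.

Theorem proposition2 (R : realType) (n : nat) (hn : (0 < n)%N)
    (delta : multinom n) (p : mpoly n R) (hp : multidegree_le delta p) :
  exists p0 p1 p2 pstar : R,
    [/\ is_min (lp0_values delta p) p0,
        is_min (lp1_values delta p) p1,
        is_min (lp2_values delta p) p2,
        is_min (poly_values p) pstar
      & [/\ p0 <= p1, p1 <= p2 & p2 <= pstar]].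
Proof.
have s3 := poly_values_sub_lp2 hp.
have s2 := @lp2_values_sub_lp1 R n delta p.
have s1 := @lp1_values_sub_lp0 R n delta p.
have ne3 := poly_values_nonempty p.
have ne2 := subset_nonempty s3 ne3.
have ne1 := subset_nonempty s2 ne2.
have ne0 := subset_nonempty s1 ne1.
have [pstar m3] := poly_min_attained p.
have [p2 m2] := lp2_min_attained ne2.
have [p1 m1] := lp1_min_attained ne1.
have [p0 m0] := lp0_min_attained ne0.
exists p0, p1, p2, pstar; split=> //.
split.
- exact: le_is_min s1 m1 m0.
- exact: le_is_min s2 m2 m1.
- exact: le_is_min s3 m3 m2.
Qed.
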